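(* Let $R$ be a commutative noetherian ring, let $\mathcal{P}$ be the class of projective $R$-modules and $\mathcal{I}$ the class of injective $R$-modules. A projective resolution $P$ of an $R$-module is minimal if and only if the canonical surjection $P_i\twoheadrightarrow \operatorname{coker}(\partial_{i+1})$ is a $\mathcal{P}$-cover for all $i\in \mathbb{Z}$. Also, an injective resolution $I$ of an $R$-module is minimal if and only if the canonical inclusion $\ker(\partial^i)\hookrightarrow I^i$ is an $\mathcal{I}$-envelope for all $i\in \mathbb{Z}$.
   Context: A projective resolution of a module $M$ is a complex $P$ of projective modules with $P_i=0$ for $i<0$, differentials $\partial_i:P_i\to P_{i-1}$, and a quasi-isomorphism $P\to M$; an injective resolution of $M$ is a complex $I$ of injective modules with $I^i=0$ for $i<0$, differentials $\partial^i:I^i\to I^{i+1}$, and a quasi-isomorphism $M\to I$. A complex $C$ is minimal if every homotopy equivalence $\gamma:C\to C$ (degree zero chain map) is an isomorphism of complexes. A morphism $\phi:P\to M$ with $P\in\mathcal{P}$ is a $\mathcal{P}$-cover if every map $P'\to M$ with $P'\in\mathcal{P}$ factors through $\phi$ and every endomorphism $f$ of $P$ with $\phi f=\phi$ is an isomorphism. A morphism $\phi:M\to E$ with $E\in\mathcal{I}$ is an $\mathcal{I}$-envelope if every map $M\to E'$ with $E'\in\mathcal{I}$ factors through $\phi$ and every endomorphism $f$ of $E$ with $f\phi=\phi$ is an isomorphism. The paper assumes throughout that $R$ is commutative and noetherian. *)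

(* Defs.v *)
From HB Require Import structures.
From mathcomp Require Import all_boot all_order all_algebra.
From mathcomp Require Import generic_quotient ring_quotient boolp.

Set Implicit Arguments.
Unset Strict Implicit.
Unset Printing Implicit Defensive.

Import GRing.Theory.
Local Open Scope ring_scope.

(* pzRing rather than nzRing: the zero ring is allowed. *)
Definition is_ideal (R : comPzRingType) (I : R -> Prop) : Prop :=
  [/\ I 0, forall x y, I x -> I y -> I (x + y) & forall a x, I x -> I (a * x)].

Definition noetherian (R : comPzRingType) : Prop :=
  forall I : R -> Prop, is_ideal I ->
    exists (n : nat) (g : 'I_n -> R),
      forall x, I x <-> exists c : 'I_n -> R, x = \sum_(k < n) c k * g k.

Section KernelCokernel.
Variables (R : pzRingType) (U V : lmodType R) (f : {linear U -> V}).

Definition ker_pred : {pred U} := fun x => f x == 0.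

Lemma ker_submod : submod_closed ker_pred.
Proof.
split; first by rewrite unfold_in linear0.
by move=> a x y; rewrite !unfold_in linearP => /eqP-> /eqP->; rewrite scaler0 addr0.
Qed.
HB.instance Definition _ := GRing.isSubmodClosed.Build R U ker_pred ker_submod.

Record ker := Ker { ker_val :> U; ker_valP : ker_val \in ker_pred }.
HB.instance Definition _ := [isSub for ker_val].
HB.instance Definition _ := [Choice of ker by <:].
HB.instance Definition _ := [SubChoice_isSubLmodule of ker by <:].

Definition ker_incl : {linear ker -> U} := (val : ker -> U).

Definition im_pred : {pred V} := fun y => `[< exists x, y = f x >].

Lemma im_submod : submod_closed im_pred.
Proof.
split; first by rewrite unfold_in; apply/asboolP; exists 0; rewrite linear0.
move=> a x y; rewrite !unfold_in => /asboolP[u ->] /asboolP[v ->].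
by apply/asboolP; exists (a *: u + v); rewrite linearP.
Qed.
HB.instance Definition _ := GRing.isSubmodClosed.Build R V im_pred im_submod.

(* The quotient of V by the image of f; the library provides its abelian group
   structure, to which the scaling is added. *)
Definition coker := Quotient.quot im_pred.
HB.instance Definition _ := GRing.Zmodule.on coker.

Local Open Scope quotient_scope.

Definition coker_proj_fun (x : V) : coker := \pi_(Quotient.quot im_pred) x.

Definition coker_scale (a : R) (x : coker) : coker :=
  coker_proj_fun (a *: repr x).

Lemma coker_proj_eq x y :
  coker_proj_fun x = coker_proj_fun y <-> x - y \in im_pred.
Proof.
rewrite /coker_proj_fun; split=> [/eqP|]; first by rewrite -Quotient.idealrBE.
by rewrite Quotient.idealrBE => /eqP.
Qed.

Lemma coker_proj_repr (x : coker) : coker_proj_fun (repr x) = x.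
Proof. exact: reprK. Qed.

Lemma coker_projD : {morph coker_proj_fun : x y / x + y}.
Proof. by move=> x y; rewrite /coker_proj_fun; exact: Quotient.pi_add. Qed.

Lemma coker_projZ a x : coker_proj_fun (a *: x) = coker_scale a (coker_proj_fun x).
Proof.
apply/coker_proj_eq; rewrite -scalerBr rpredZ //.
by apply/coker_proj_eq; rewrite coker_proj_repr.
Qed.

Lemma coker_scaleA a b v :
  coker_scale a (coker_scale b v) = coker_scale (a * b) v.
Proof. by rewrite -[v]coker_proj_repr -!coker_projZ scalerA. Qed.

Lemma coker_scale1 : left_id 1 coker_scale.
Proof. by move=> v; rewrite -[v]coker_proj_repr -!coker_projZ scale1r. Qed.

Lemma coker_scaleDr : right_distributive coker_scale +%R.
Proof.
move=> a u v; rewrite -[u]coker_proj_repr -[v]coker_proj_repr.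
by rewrite -coker_projD -!coker_projZ scalerDr coker_projD.
Qed.

Lemma coker_scaleDl v : {morph coker_scale^~ v : a b / a + b}.
Proof.
move=> a b; rewrite -[v]coker_proj_repr -!coker_projZ scalerDl.
exact: coker_projD.
Qed.

HB.instance Definition _ := GRing.Zmodule_isLmodule.Build R coker
  coker_scaleA coker_scale1 coker_scaleDr coker_scaleDl.

Lemma coker_proj_linear : linear coker_proj_fun.
Proof. by move=> a x y; rewrite coker_projD coker_projZ. Qed.
HB.instance Definition _ :=
  GRing.isLinear.Build R V coker _ coker_proj_fun coker_proj_linear.

Definition coker_proj : {linear V -> coker} := coker_proj_fun.

End KernelCokernel.

Section ModuleClasses.
Variable R : pzRingType.

Definition projective (P : lmodType R) : Prop :=
  forall (A B : lmodType R) (p : {linear A -> B}) (g : {linear P -> B}),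
    (forall b, exists a, p a = b) ->
    exists h : {linear P -> A}, forall x, p (h x) = g x.

Definition injective_mod (E : lmodType R) : Prop :=
  forall (A B : lmodType R) (j : {linear A -> B}) (g : {linear A -> E}),
    injective j ->
    exists h : {linear B -> E}, forall x, h (j x) = g x.

Definition is_cover (X : lmodType R -> Prop) (P M : lmodType R)
    (phi : {linear P -> M}) : Prop :=
  [/\ X P,
      forall (P' : lmodType R) (g : {linear P' -> M}), X P' ->
        exists h : {linear P' -> P}, forall x, phi (h x) = g x
    & forall f : {linear P -> P}, (forall x, phi (f x) = phi x) -> bijective f].

Definition is_envelope (X : lmodType R -> Prop) (M E : lmodType R)
    (phi : {linear M -> E}) : Prop :=
  [/\ X E,
      forall (E' : lmodType R) (g : {linear M -> E'}), X E' ->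
        exists h : {linear E -> E'}, forall x, h (phi x) = g x
    & forall f : {linear E -> E}, (forall x, f (phi x) = phi x) -> bijective f].

End ModuleClasses.

(* Complexes indexed by the integers.  To cover both indexing conventions without
   transporting along equalities of degrees, there is a map diff i j for all i
   and j, which is required to vanish unless the shape e relates i to j. *)
Definition homological : rel int := fun i j => i == j + 1.
Definition cohomological : rel int := fun i j => j == i + 1.

Record complex (R : pzRingType) (e : rel int) := Complex {
  obj :> int -> lmodType R;
  diff : forall i j, {linear obj i -> obj j};
  diff_shape : forall i j, ~~ e i j -> forall x, diff i j x = 0;
  diff_diff : forall i j k x, diff j k (diff i j x) = 0
}.
Arguments diff {R e} c i j.

Record chain_map (R : pzRingType) (e : rel int) (C D : complex R e) := ChainMap {
  component :> forall i, {linear C i -> D i};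
  component_diff : forall i j x,
    component j (diff C i j x) = diff D i j (component i x)
}.

Section ChainMaps.
Variables (R : pzRingType) (e : rel int).
Implicit Types C D E : complex R e.

Definition chain_id C : chain_map C C :=
  @ChainMap R e C C (fun i => idfun : {linear C i -> C i})
    (fun i j x => erefl).

Lemma chain_comp_diff C D E (g : chain_map D E) (f : chain_map C D) i j x :
  (g j \o f j) (diff C i j x) = diff E i j ((g i \o f i) x).
Proof. by rewrite /= !component_diff. Qed.

Definition chain_comp C D E (g : chain_map D E) (f : chain_map C D) :
    chain_map C E :=
  @ChainMap R e C E (fun i => (g i \o f i) : {linear C i -> E i})
    (chain_comp_diff g f).

(* For the two shapes above, every i has exactly one k and one j with k -> i -> j;
   the entries s i j of a homotopy at other pairs of degrees play no role. *)
Definition homotopic C D (f g : chain_map C D) : Prop :=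
  exists s : forall i j, {linear C i -> D j},
    forall k i j, e k i -> e i j -> forall x,
      f i x - g i x = diff D k i (s i k x) + s j i (diff C i j x).

Definition homotopy_equivalence C D (f : chain_map C D) : Prop :=
  exists g : chain_map D C,
    homotopic (chain_comp g f) (chain_id C) /\
    homotopic (chain_comp f g) (chain_id D).

Definition complex_iso C D (f : chain_map C D) : Prop :=
  exists g : chain_map D C,
    (forall i x, g i (f i x) = x) /\ (forall i y, f i (g i y) = y).

Definition minimal C : Prop :=
  forall f : chain_map C C, homotopy_equivalence f -> complex_iso f.

(* The map induced by f on cycles modulo boundaries is injective and surjective
   in every degree. *)
Definition quasi_iso C D (f : chain_map C D) : Prop :=
  forall k i j, e k i -> e i j ->
    (forall x, diff C i j x = 0 ->
       (exists y, f i x = diff D k i y) -> exists y, x = diff C k i y) /\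
    (forall z, diff D i j z = 0 ->
       exists x, diff C i j x = 0 /\ exists y, z - f i x = diff D k i y).

(* M in degree 0, and the zero module of row vectors of length 0 elsewhere. *)
Definition concentrated_obj (M : lmodType R) (i : int) : lmodType R :=
  match i with Posz 0 => M | _ => 'rV[R]_0 end.

Definition concentrated_diff (M : lmodType R) (i j : int) :
    {linear concentrated_obj M i -> concentrated_obj M j} :=
  \0.

Definition concentrated (M : lmodType R) : complex R e :=
  @Complex R e (concentrated_obj M) (concentrated_diff M)
    (fun _ _ _ _ => erefl) (fun _ _ _ _ => erefl).

End ChainMaps.

Definition projective_resolution (R : pzRingType) (M : lmodType R)
    (P : complex R homological) : Prop :=
  [/\ forall i, projective (P i),
      forall i, i < 0 -> forall x : P i, x = 0
    & exists p : chain_map P (concentrated homological M), quasi_iso p].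

Definition injective_resolution (R : pzRingType) (M : lmodType R)
    (I : complex R cohomological) : Prop :=
  [/\ forall i, injective_mod (I i),
      forall i, i < 0 -> forall x : I i, x = 0
    & exists p : chain_map (concentrated cohomological M) I, quasi_iso p].

(* Main.v *)
Require Import Defs.
From HB Require Import structures.
From mathcomp Require Import all_boot all_order all_algebra.
From mathcomp Require Import boolp zify.

(** A chain endomorphism of the form 1 + d s + s d is homotopic to the identity,
    and minimality says exactly that all such endomorphisms are invertible
    ([homotopic_id_bijective_minimal] and the construction [perturb]).

    If C is minimal and s is one linear map C_i -> C_k, with d : C_k -> C_i, then
    extending s by zero to a homotopy shows that 1 + d s on C_i and 1 + s d on
    C_k are bijective ([minimal_bijective]).  When C_i is projective, every
    endomorphism of C_i that is the identity modulo the image of d has the form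
    1 + d s; when C_k is injective, every endomorphism of C_k that is the
    identity on the kernel of d has the form 1 + s d ([projective_lift],
    [injective_extension]).  This gives the cover and envelope properties.

    Conversely, let F = 1 + d s + s d and suppose that F is bijective in the
    degrees i - 1 and i - 2.  In degree i the summand s d (homologically) or d s
    (cohomologically) keeps F from being the identity modulo boundaries or on
    cycles, but it can be corrected: for h = 1 - s F^-1 d, respectively
    h = 1 - d F^-1 s, both F h and h F are the identity modulo boundaries,
    respectively on cycles.  The cover or envelope property makes F h and h F
    bijective, hence F is bijective in degree i ([bijective_mod_boundaries],
    [bijective_on_cycles]).  As the complex vanishes in
    negative degrees, induction on i finishes the proof. *)

Set Implicit Arguments.
Unset Strict Implicit.
Unset Printing Implicit Defensive.

Import GRing.Theory.
Local Open Scope ring_scope.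

(** * Linear maps *)

Lemma bijective_two_sided (A B : Type) (f : A -> B) (g g' : B -> A) :
  bijective (g \o f) -> bijective (f \o g') -> bijective f.
Proof.
move=> [a gfK _] [b _ fgK]; have fK : cancel f (a \o g) by exact: gfK.
by exists (a \o g) => // y; rewrite -[y]fgK /= [a _]fK.
Qed.

Section LinearMaps.
Variable R : pzRingType.

Definition Linear (U V : lmodType R) (f : U -> V) (lin_f : linear f) :
    {linear U -> V} :=
  HB.pack_for {linear U -> V} f (GRing.isLinear.Build R U V *:%R f lin_f).

Lemma bijective_linear_inverse (U V : lmodType R) (f : {linear U -> V}) :
  bijective f -> exists g : {linear V -> U}, cancel f g /\ cancel g f.
Proof.
move=> [g fK gK]; have lin_g : linear g by exact: can2_linear fK gK.
by exists (Linear lin_g).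
Qed.

(** The pullback of f and g maps onto P, and a section of this projection,
    followed by the projection to A, is the lift. *)
Lemma projective_lift (P A B : lmodType R) (f : {linear A -> B})
    (g : {linear P -> B}) :
  projective P -> (forall x, exists a, f a = g x) ->
  exists h : {linear P -> A}, forall x, f (h x) = g x.
Proof.
move=> projP gf.
pose q : {linear (A * P)%type -> B} := (f \o fst) \- (g \o snd).
pose p : {linear ker q -> P} := snd \o ker_incl q.
have [|r pr] := projP _ _ p idfun.
  move=> x; have [a fa] := gf x.
  have qax : (a, x) \in ker_pred q by rewrite unfold_in /= fa subrr.
  by exists (Ker qax).
exists (fst \o ker_incl q \o r) => x /=.
have /eqP := ker_valP (r x); rewrite /= => /subr0_eq ->.
by congr (g _); exact: pr.
Qed.

(** Dually, E embeds into the pushout of f and g because g vanishes on the kernel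
    of f, and a retraction of this embedding restricts to the extension. *)
Lemma injective_extension (E A B : lmodType R) (f : {linear A -> B})
    (g : {linear A -> E}) :
  injective_mod E -> (forall x, f x = 0 -> g x = 0) ->
  exists h : {linear B -> E}, forall x, h (f x) = g x.
Proof.
move=> injE gf.
have lin_q : linear (fun a : A => (f a, - g a)).
  by move=> c x y; congr pair; rewrite /= linearP /= ?opprD ?scalerN.
pose q : {linear A -> (B * E)%type} := Linear lin_q.
have lin_l : linear (fun b : B => (b, 0 : E)).
  by move=> c x y; congr pair; rewrite /= scaler0 addr0.
pose l : {linear B -> (B * E)%type} := Linear lin_l.
have lin_r : linear (fun e : E => (0 : B, e)).
  by move=> c x y; congr pair; rewrite /= scaler0 addr0.
pose r : {linear E -> (B * E)%type} := Linear lin_r.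
have [|t tr] := injE _ _ (coker_proj q \o r : {linear E -> coker q}) idfun.
  move=> x y /= /coker_proj_eq; rewrite unfold_in => /asboolP[a /= []].
  rewrite subr0 => /esym /gf -> /eqP.
  by rewrite oppr0 subr_eq0 => /eqP.
exists (t \o coker_proj q \o l) => x /=.
rewrite -[RHS]tr /=; congr (t _); apply/coker_proj_eq.
rewrite unfold_in; apply/asboolP; exists x.
by congr pair; rewrite /= ?subr0 ?sub0r.
Qed.

(** * Covers and envelopes *)

(** Maps from projective modules always lift through the surjection onto the
    cokernel, so only the condition on endomorphisms remains. *)
Lemma is_cover_coker_proj (A P : lmodType R) (d : {linear A -> P}) :
  projective P ->
  is_cover (@projective R) (coker_proj d) <->
  forall f : {linear P -> P},
    (forall x, exists u, f x - x = d u) -> bijective f.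
Proof.
move=> projP; have imE (f : {linear P -> P}) :
    (forall x, coker_proj d (f x) = coker_proj d x) <->
    (forall x, exists u, f x - x = d u).
  split=> fd x; first by have /coker_proj_eq/asboolP := fd x.
  by apply/coker_proj_eq; rewrite unfold_in; apply/asboolP; exact: fd.
split=> [[_ _ coverP] f /imE /coverP //|minP]; split=> //.
  move=> P' g projP'; apply: projP' => b.
  by exists (repr b); exact: coker_proj_repr.
by move=> f /imE /minP.
Qed.

Lemma is_envelope_ker_incl (E B : lmodType R) (d : {linear E -> B}) :
  injective_mod E ->
  is_envelope (@injective_mod R) (ker_incl d) <->
  forall f : {linear E -> E}, (forall x, d x = 0 -> f x = x) -> bijective f.
Proof.
move=> injE; have kerE (f : {linear E -> E}) :
    (forall z, f (ker_incl d z) = ker_incl d z) <->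
    (forall x, d x = 0 -> f x = x).
  split=> [fd x /eqP dx|fd z]; last by apply: fd; apply/eqP; exact: ker_valP.
  exact: (fd (Ker (dx : x \in ker_pred d))).
split=> [[_ _ envE] f /kerE /envE //|minE]; split=> //.
  by move=> E' g injE'; apply: injE'; exact: val_inj.
by move=> f /kerE /minE.
Qed.

End LinearMaps.

(** * Minimality and endomorphisms homotopic to the identity *)

Section Minimality.
Variables (R : pzRingType) (e : rel int).
Implicit Types C D : complex R e.

Lemma bijective_complex_iso C D (f : chain_map C D) :
  (forall i, bijective (f i)) -> complex_iso f.
Proof.
move=> bij_f.
pose G i := cid (bijective_linear_inverse (bij_f i)).
pose g i : {linear D i -> C i} := sval (G i).
have fK i : cancel (f i) (g i) by case: (svalP (G i)).
have gK i : cancel (g i) (f i) by case: (svalP (G i)).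
have gd i j x : g j (diff D i j x) = diff C i j (g i x).
  by rewrite -[RHS]fK component_diff gK.
by exists (ChainMap gd).
Qed.

(** If g is a homotopy inverse of f, the hypothesis applies to g f and f g, so that
    f has a left and a right inverse in each degree. *)
Lemma homotopic_id_bijective_minimal C :
  (forall F : chain_map C C, homotopic F (chain_id C) ->
     forall i, bijective (F i)) ->
  minimal C.
Proof.
move=> bijC f [g [gf fg]]; apply: bijective_complex_iso => i.
exact: (bijective_two_sided (bijC _ gf i) (bijC _ fg i)).
Qed.

(** Extension by zero of one map to a family indexed by all pairs of degrees; the
    transport along equalities of degrees that this needs is confined here. *)
Lemma single_homotopy (C : int -> lmodType R) i0 j0
    (s0 : {linear C i0 -> C j0}) :
  exists s : forall i j, {linear C i -> C j},
    (forall x, s i0 j0 x = s0 x) /\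
    (forall i j, i != i0 -> forall x, s i j x = 0).
Proof.
pose s i j : {linear C i -> C j} :=
  match i0 =P i, j0 =P j with
  | ReflectT ei, ReflectT ej =>
      match ei in _ = i', ej in _ = j' return {linear C i' -> C j'} with
      | erefl, erefl => s0
      end
  | _, _ => \0
  end.
exists s; split=> [x|i j ne_i x]; rewrite /s.
  case: eqP => // ei; case: eqP => // ej.
  by rewrite (eq_irrelevance ei erefl) (eq_irrelevance ej erefl).
by case: eqP => // ei; rewrite ei eqxx in ne_i.
Qed.

(* The differential goes from degree i to degree next i; both shapes of complexes
   are covered. *)
Variables (next prev : int -> int).
Hypothesis shapeE : forall i j, e i j = (j == next i).
Hypothesis nextK : cancel next prev.

Section Perturbation.
Variables (C : complex R e) (s : forall i j, {linear C i -> C j}).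

Definition perturb_component i : {linear C i -> C i} :=
  idfun \+ ((diff C (prev i) i \o s i (prev i))
            \+ (s (next i) i \o diff C i (next i))).

Lemma perturb_diff i j x :
  perturb_component j (diff C i j x) = diff C i j (perturb_component i x).
Proof.
have [eij|/diff_shape nij] := boolP (e i j); last by rewrite !nij linear0.
move: eij; rewrite shapeE => /eqP ->.
rewrite /= !linearD /= !diff_diff linear0 add0r addr0.
by rewrite nextK.
Qed.

Definition perturb : chain_map C C := ChainMap perturb_diff.

Lemma perturb_homotopic : homotopic perturb (chain_id C).
Proof.
exists s => k i j; rewrite !shapeE => /eqP -> /eqP -> x /=.
by rewrite nextK addrC addKr.
Qed.

Lemma perturb_homotopy_equivalence : homotopy_equivalence perturb.
Proof.
by have [t tE] := perturb_homotopic; exists (chain_id C); split; exists t.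
Qed.

End Perturbation.

(** Extending s by zero to a homotopy, the chain map 1 + d s + s d is 1 + d s in
    degree i and 1 + s d in degree k, and minimality makes it invertible. *)
Lemma minimal_bijective C i k (s : {linear C i -> C k}) :
  minimal C -> e k i -> k != i ->
  bijective (fun x => x + diff C k i (s x)) /\
  bijective (fun x => x + s (diff C k i x)).
Proof.
move=> minC; rewrite shapeE => /eqP ek ne_ki.
have [t [tE t0]] := single_homotopy s.
have [G [GK KG]] := minC _ (perturb_homotopy_equivalence t).
have bij j : bijective (perturb t j) by exact: Bijective (GK j) (KG j).
have ki : k = prev i by rewrite ek nextK.
split.
  apply: (eq_bij (bij i)) => x /=.
  rewrite -ki tE (t0 (next i)) ?addr0 //.
  by apply: contra_neq ne_ki => fix_i; rewrite ki -{1}fix_i nextK.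
apply: (eq_bij (bij k)) => x /=.
by rewrite -ek tE t0 // linear0 add0r.
Qed.

End Minimality.

(** * Correcting an endomorphism homotopic to the identity *)

Section Correction.
Variables (R : pzRingType) (e : rel int) (C : complex R e) (F : chain_map C C).
Hypothesis F1 : homotopic F (chain_id C).

(** The correction is h = 1 - s F^-1 d.  For w = F^-1 d x, which is a cycle, the
    homotopy gives d s w = d x - w, so that d h x = w and the two terms s w in
    F h x cancel. *)
Lemma bijective_mod_boundaries k i j l :
  e k i -> e i j -> e j l ->
  (forall f : {linear C i -> C i},
     (forall x, exists u, f x - x = diff C k i u) -> bijective f) ->
  injective (F l) -> bijective (F j) -> bijective (F i).
Proof.
move=> eki eij ejl minC injFl /bijective_linear_inverse[G [FK GK]].
have [s sE] := F1.
pose h : {linear C i -> C i} := idfun \- (s j i \o G \o diff C i j).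
apply: (@bijective_two_sided _ _ _ h h).
  apply: (minC (h \o F i)) => x; exists (s i k x) => /=.
  rewrite -component_diff FK addrAC.
  by rewrite [X in X - _](sE k i j eki eij x) addrK.
apply: (minC (F i \o h)) => x; exists (s i k (h x)).
set w := G (diff C i j x).
have dw : diff C j l w = 0.
  by apply: injFl; rewrite component_diff GK diff_diff linear0.
have dsw : diff C i j (s j i w) = diff C i j x - w.
  have /= := sE i j l eij ejl w; rewrite dw linear0 addr0 => <-.
  by rewrite GK.
have dh : diff C i j (h x) = w by rewrite /= linearB /= dsw subKr.
have /= := sE k i j eki eij (h x); rewrite dh => Fh.
rewrite /=; apply/eqP; rewrite -(inj_eq (addIr (s j i w))) -Fh; apply/eqP.
by rewrite opprB addrA addrAC.
Qed.

(** The correction is h = 1 - d F^-1 s, the dual of the preceding one: on cycles F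
    is 1 + d s, and d F^-1 vanishes on boundaries because F is onto two degrees
    below. *)
Lemma bijective_on_cycles m k i j :
  e m k -> e k i -> e i j ->
  (forall f : {linear C i -> C i},
     (forall x, diff C i j x = 0 -> f x = x) -> bijective f) ->
  (forall y, exists x, F m x = y) -> bijective (F k) -> bijective (F i).
Proof.
move=> emk eki eij minC surFm /bijective_linear_inverse[G [FK GK]].
have [s sE] := F1.
pose h : {linear C i -> C i} := idfun \- (diff C k i \o G \o s i k).
have FE x : diff C i j x = 0 -> F i x = x + diff C k i (s i k x).
  move=> dx; have /= := sE k i j eki eij x; rewrite dx linear0 addr0 => <-.
  by rewrite addrC subrK.
have sdE v : s i k (diff C k i v) = F k v - v - diff C m k (s k m v).
  by rewrite [X in X - _](sE m k i emk eki v) addrC addKr.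
apply: (@bijective_two_sided _ _ _ h h).
  apply: (minC (h \o F i)) => x dx /=.
  rewrite FE //; set v := s i k x.
  have dGd : diff C k i (G (diff C m k (s k m v))) = 0.
    have [u <-] := surFm (s k m v).
    by rewrite -component_diff FK diff_diff.
  have -> : s i k (x + diff C k i v) = F k v - diff C m k (s k m v).
    by rewrite linearD /= sdE -/v addrA addrCA subrr addr0.
  by rewrite (linearB G) FK (linearB (diff C k i)) /= dGd subr0 addrK.
apply: (minC (F i \o h)) => x dx /=.
rewrite FE; last by rewrite linearB /= dx diff_diff subr0.
set w := G (s i k x).
have -> : s i k (x - diff C k i w) = w + diff C m k (s k m w).
  by rewrite linearB /= sdE GK -addrA -opprD subKr.
by rewrite linearD /= diff_diff addr0 subrK.
Qed.

End Correction.

(** * Complexes vanishing in negative degrees *)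

Lemma int_ind_from0 (Q : int -> Prop) :
  (forall i, i < 0 -> Q i) ->
  (forall i, Q (i - 1) -> Q (i - 2) -> Q i) ->
  forall i, Q i.
Proof.
move=> Qneg Qstep.
have Qlt (n : nat) i : i < n%:Z -> Q i.
  elim: n i => [|n IHn] i lt_in; first exact: Qneg.
  by apply: Qstep; apply: IHn; lia.
by move=> i; apply: (Qlt `|i|.+1%N); lia.
Qed.

Lemma bijective_trivial (T : nmodType) (f : T -> T) :
  (forall x : T, x = 0) -> bijective f.
Proof. by move=> T0; exists id => x; rewrite [LHS]T0 [RHS]T0. Qed.

Lemma bijective_surjective (A B : Type) (f : A -> B) :
  bijective f -> forall y, exists x, f x = y.
Proof. by move=> [g _ gK] y; exists (g y). Qed.

Lemma homologicalE i j : homological i j = (j == i - 1).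
Proof. by rewrite /homological; apply/eqP/eqP => ->; rewrite ?addrK ?subrK. Qed.

Section Resolutions.
Variable R : pzRingType.

Lemma minimal_projective_complex (P : complex R homological) :
  (forall i, projective (P i)) -> (forall i, i < 0 -> forall x : P i, x = 0) ->
  minimal P <->
  forall i, is_cover (@projective R) (coker_proj (diff P (i + 1) i)).
Proof.
move=> projP P0; split=> [minP i|coverP].
  apply/is_cover_coker_proj => // f f1.
  have [|s sE] :=
    @projective_lift _ _ _ _ (diff P (i + 1) i) (f \- idfun) (projP i).
    by move=> x; have [u] := f1 x; exists u.
  have [||bij _] := @minimal_bijective _ _ (fun i => i - 1) (+%R^~ 1)
    homologicalE (subrK 1) _ _ _ s minP.
  - by rewrite /homological.
  - lia.
  by apply: (eq_bij bij) => x; rewrite sE /= addrC subrK.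
apply: homotopic_id_bijective_minimal => F F1.
apply: int_ind_from0 => [i /P0|i bij1 bij2]; first exact: bijective_trivial.
apply: (@bijective_mod_boundaries _ _ _ _ F1 (i + 1) i (i - 1) (i - 2)) => //.
- by rewrite /homological.
- by rewrite /homological; lia.
- by rewrite /homological; lia.
- exact/is_cover_coker_proj.
- exact: bij_inj.
Qed.

Lemma minimal_injective_complex (I : complex R cohomological) :
  (forall i, injective_mod (I i)) ->
  (forall i, i < 0 -> forall x : I i, x = 0) ->
  minimal I <->
  forall i, is_envelope (@injective_mod R) (ker_incl (diff I i (i + 1))).
Proof.
move=> injI I0; split=> [minI i|envI].
  apply/is_envelope_ker_incl => // f f1.
  have [|s sE] :=
    @injective_extension _ _ _ _ (diff I i (i + 1)) (f \- idfun) (injI i).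
    by move=> x /f1 /= ->; rewrite subrr.
  have [||_ bij] := @minimal_bijective _ _ (+%R^~ 1) (fun i => i - 1)
    (fun _ _ => erefl) (addrK 1) _ _ _ s minI.
  - by rewrite /cohomological.
  - lia.
  by apply: (eq_bij bij) => x; rewrite sE /= addrC subrK.
apply: homotopic_id_bijective_minimal => F F1.
apply: int_ind_from0 => [i /I0|i bij1 bij2]; first exact: bijective_trivial.
apply: (@bijective_on_cycles _ _ _ _ F1 (i - 2) (i - 1) i (i + 1)) => //.
- by rewrite /cohomological; lia.
- by rewrite /cohomological; lia.
- by rewrite /cohomological.
- exact/is_envelope_ker_incl.
- exact: bijective_surjective.
Qed.

End Resolutions.

Theorem mainTheorem5 (R : comPzRingType) (hR : noetherian R) :
  (forall (M : lmodType R) (P : complex R homological),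
     projective_resolution M P ->
     (minimal P <->
      forall i : int, is_cover (@projective R) (coker_proj (diff P (i + 1) i)))) /\
  (forall (M : lmodType R) (I : complex R cohomological),
     injective_resolution M I ->
     (minimal I <->
      forall i : int,
        is_envelope (@injective_mod R) (ker_incl (diff I i (i + 1))))).
Proof.
split=> [M P [projP P0 _]|M I [injI I0 _]].
  exact: minimal_projective_complex.
exact: minimal_injective_complex.
Qed.
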